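(* Let $X$ be a Hausdorff topological space. Suppose that for every function $f: X \to \mathbb{R} \cup \{+\infty\}$ which is proper, lower semicontinuous and bounded from below, and for every $x_0 \in \operatorname{dom} f$, there exists a continuous bounded function $h: X \to \mathbb{R}_+$ with $h(x_0)=0$ and $\|h\|_{\infty} = f(x_0) - \inf_X f$ such that the function $f+h$ attains its minimum on $X$ at $x_0$. Then $X$ is a completely regular topological space.
   Context: $\mathbb{R}_+$ denotes the set of nonnegative real numbers. For an extended real-valued function $f$ on $X$, $\operatorname{dom} f$ is the set of points of $X$ at which $f$ has a finite value, and $f$ is proper if $\operatorname{dom} f \neq \emptyset$. For a bounded function $h:X\to\mathbb{R}$, $\|h\|_\infty := \sup\{|h(x)| : x\in X\}$. A topological space $X$ is completely regular if it is Hausdorff and for every set $A\subset X$ and every point $x\in X\setminus\overline{A}$ there exists a continuous function $f:X\to\mathbb{R}$ such that $f(x)\notin\overline{f(A)}$ (equivalently, it is Hausdorff and for every closed set $A$ and every point $x\notin A$ there is a continuous function $f:X\to[0,1]$ with $f(x)=0$ and $f\equiv 1$ on $A$). *)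

(* Defs.v *)
From mathcomp Require Import all_boot all_order all_algebra.
From mathcomp Require Import all_classical all_reals ereal topology normedtype.
Set Implicit Arguments.
Unset Strict Implicit.
Unset Printing Implicit Defensive.
Import Order.TTheory GRing.Theory Num.Theory.
Import numFieldNormedType.Exports.
Local Open Scope classical_set_scope.
Local Open Scope ring_scope.

Definition edom (R : realType) (X : Type) (f : X -> \bar R) : set X :=
  [set x | f x \is a fin_num].

Definition proper_fun (R : realType) (X : Type) (f : X -> \bar R) : Prop :=
  edom f !=set0.

Definition bounded_below (R : realType) (X : Type) (f : X -> \bar R) : Prop :=
  exists m : R, forall x, (m%:E <= f x)%E.

(* [sup] is total: this is the uniform norm only for bounded [h] on a
   nonempty [X]. *)
Definition sup_norm (R : realType) (X : Type) (h : X -> R) : R :=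
  sup (range (fun x => `|h x|)).

Definition attains_min_at (R : realType) (X : Type) (g : X -> \bar R)
    (x0 : X) : Prop :=
  forall x, (g x0 <= g x)%E.

(* The library's [completely_regular_space] is phrased through uniformities
   and does not include the Hausdorff axiom; here complete regularity is
   expressed with real-valued functions. *)
Definition completely_regular (R : realType) (X : topologicalType) : Prop :=
  hausdorff_space X /\
  forall (A : set X) (x : X), ~ closure A x ->
    exists f : X -> R, continuous f /\ ~ closure (f @` A) (f x).

(* Main.v *)
Require Import Defs.
From mathcomp Require Import all_boot all_order all_algebra.
From mathcomp Require Import all_classical all_reals ereal topology normedtype numfun.
Set Implicit Arguments.
Unset Strict Implicit.
Unset Printing Implicit Defensive.
Import Order.TTheory GRing.Theory Num.Theory.
Import numFieldNormedType.Exports.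
Local Open Scope classical_set_scope.
Local Open Scope ring_scope.

(** To separate a point [x] from a set [A] whose closure misses it, perturb the
    indicator function of the complement of [closure A].  It is lower
    semicontinuous because that complement is open, and it takes the value 1 at
    [x] and 0 on [A].  If adding a continuous [h] with [h x = 0] makes [x] a
    global minimum, then comparing the values at [x] and at a point [a] of [A]
    gives [1 <= h a]: hence [h] maps [A] into the closed half-line of reals at
    least 1 and sends [x] to 0, outside of it. *)

Lemma lower_semicontinuous_indic_open (R : realType) (X : topologicalType)
  (U : set X) :
  open U -> lower_semicontinuous (fun x => (\1_U x : R)%:E).
Proof.
move=> oU x a; rewrite lte_fin => ax; case: (pselect (U x)) => Ux.
  exists U; first exact: open_nbhs_nbhs.
  by move=> y Uy; move: ax; rewrite !indicE !mem_set.
(* Off [U] the indicator takes its least value, so the bound holds globally. *)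
exists setT; first exact: filterT.
move=> y _; rewrite lte_fin; apply: (lt_le_trans ax).
by rewrite !indicE memNset// ler0n.
Qed.

Theorem theorem2p2 (R : realType) (X : topologicalType)
  (hX : hausdorff_space X)
  (hpert : forall f : X -> \bar R,
     (forall x, f x != -oo%E) ->
     proper_fun f -> lower_semicontinuous f -> bounded_below f ->
     forall x0 : X, edom f x0 ->
     exists h : X -> R,
       [/\ continuous h /\ bounded_fun h,
           forall x, 0 <= h x,
           h x0 = 0,
           ((sup_norm h)%:E = f x0 - ereal_inf (range f))%E
         & attains_min_at (fun x => (f x + (h x)%:E)%E) x0]) :
  completely_regular R X.
Proof.
split=> // A x nAx.
have oU : open (~` closure A) by exact/closed_openC/closed_closure.
have [|||||h [[ch _] _ hx0 _ hmin]] :=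
  hpert (fun x => (\1_(~` closure A) x : R)%:E) _ _ _ _ x _ => //.
- by exists x.
- exact: lower_semicontinuous_indic_open.
- by exists 0 => y; rewrite lee_fin indicE ler0n.
exists h; split=> // clhx.
have hA : h @` A `<=` [set r | 1 <= r].
  move=> _ [a Aa <-] /=; have := hmin a.
  rewrite -!EFinD lee_fin !indicE mem_set// memNset ?hx0 ?addr0 ?add0r//.
  by apply; exact: subset_closure.
have := closure_subset hA clhx.
rewrite -(closure_id _).1 ?hx0 /=; last exact: closed_ge.
by rewrite ler10.
Qed.
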